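(* Let $\mathbf w$ and $\mathbf w'$ be the MMD weights from datasets $\mathcal D$ and $\mathcal D'$ of size $n$ that differ at one point. Assume that $|K(\mathbf x_i,\mathbf x_j)|\le C$ for some constant $C>0$ for all $i,j$ (for the covariates of both datasets), and that $\|\mathbf w\|_\infty,\|\mathbf w'\|_\infty\le R_{\mathrm{MMD}}$. Then $$\|\mathbf w-\mathbf w'\|_2\le\frac{2\sqrt2\,(R_{\mathrm{MMD}}+1)\,C\,n}{\lambda_{\mathrm{MMD}}}.$$
   Context: A dataset is $\mathcal D=\{(\mathbf x_i,a_i)\}_{i=1}^n$ with covariates $\mathbf x_i\in\mathcal X$ and treatments $a_i\in\{0,1\}$. $K:\mathcal X\times\mathcal X\to\mathbb R$ is the kernel of a reproducing kernel Hilbert space, $\alpha\in[0,1]$ and $\lambda_{\mathrm{MMD}}>0$ are fixed. The MMD weights of $\mathcal D$ (coordinates indexed by records $i=1,\dots,n$) are $$\mathbf w(\mathcal D)=\arg\min_{\mathbf w\in\mathbb R^n,\ \|\mathbf w\|_\infty\le R_{\mathrm{MMD}}}\big[\mathbf w^\top\mathbf A\mathbf w-2\mathbf w^\top\mathbf b\big],$$ where $\mathbf A=\mathbf A(\mathcal D,\alpha,\lambda_{\mathrm{MMD}})\in\mathbb R^{n\times n}$ and $\mathbf b=\mathbf b(\mathcal D,\alpha)\in\mathbb R^n$ have entries $$\mathbf A_{ij}=\frac1{n^2}\big(s_{ij}K(\mathbf x_i,\mathbf x_j)+\lambda_{\mathrm{MMD}}\mathbf 1\{i=j\}\big),\quad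 s_{ij}=\begin{cases}1&a_i=a_j\\ \alpha-1&a_i\neq a_j\end{cases},\qquad\mathbf b_i=\frac\alpha{n^2}\sum_{j=1}^nK(\mathbf x_i,\mathbf x_j).$$ *)

(* Defs.v *)
From HB Require Import structures.
From mathcomp Require Import all_boot all_order all_algebra.
From mathcomp Require Import all_classical all_reals all_analysis.
Export numFieldNormedType.Exports.

Set Implicit Arguments.
Unset Strict Implicit.
Unset Printing Implicit Defensive.

Import Order.TTheory GRing.Theory Num.Theory.
Local Open Scope ring_scope.

(* [H] is a real Hilbert space of functions on [X] with reproducing kernel [K].
   An element [f : H] stands for the function [x |-> ev x f]; [rkhs_inj] says
   that this representation is faithful.  The last field is the membership of
   the sections [K (-, x)] in [H] together with the reproducing property. *)
Record is_rkhs (R : realType) (X : Type) (H : completeNormedModType R)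
    (dot : {dot H for idfun}) (ev : X -> {scalar H}) (K : X -> X -> R) : Prop :=
  IsRkhs {
    rkhs_norm : forall f : H, `|f| ^+ 2 = dot f f;
    rkhs_inj : forall f g : H, (forall x, ev x f = ev x g) -> f = g;
    rkhs_reproducing : forall x, exists kx : H,
      (forall y, ev y kx = K y x) /\ (forall f : H, ev x f = dot f kx)
  }.

Definition reproducing_kernel (R : realType) (X : Type) (K : X -> X -> R) : Prop :=
  exists (H : completeNormedModType R) (dot : {dot H for idfun})
    (ev : X -> {scalar H}), is_rkhs dot ev K.

(* Treatment 1 is [true], treatment 0 is [false]. *)
Definition dataset (X : Type) (n : nat) := 'I_n -> X * bool.

Definition covariate (X : Type) (n : nat) (D : dataset X n) (i : 'I_n) : X :=
  (D i).1.

Definition treatment (X : Type) (n : nat) (D : dataset X n) (i : 'I_n) : bool :=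
  (D i).2.

(* The two records at index [k] are arbitrary, in particular allowed to agree. *)
Definition differ_at_one_point (X : Type) (n : nat) (D D' : dataset X n) : Prop :=
  exists k : 'I_n, forall i : 'I_n, i != k -> D i = D' i.

Section MMD.
Variables (R : realType) (X : Type) (K : X -> X -> R) (alpha lambda : R).
Variables (n : nat) (D : dataset X n).

Definition mmd_sign (i j : 'I_n) : R :=
  if treatment D i == treatment D j then 1 else alpha - 1.

Definition mmd_A : 'M[R]_n :=
  \matrix_(i, j) ((n%:R ^+ 2)^-1 *
    (mmd_sign i j * K (covariate D i) (covariate D j) + lambda * (i == j)%:R)).

Definition mmd_b : 'cV[R]_n :=
  \col_i (alpha / n%:R ^+ 2 * \sum_(j < n) K (covariate D i) (covariate D j)).

Definition mmd_objective (w : 'cV[R]_n) : R :=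
  (w^T *m mmd_A *m w) 0 0 - 2 * (w^T *m mmd_b) 0 0.

(* [`|w|] on matrices is the sup norm [mx_norm]. *)
Definition mmd_weights (Rmmd : R) (w : 'cV[R]_n) : Prop :=
  `|w| <= Rmmd /\
  forall v : 'cV[R]_n, `|v| <= Rmmd -> mmd_objective w <= mmd_objective v.
End MMD.

Definition norm2 (R : realType) (n : nat) (v : 'cV[R]_n) : R :=
  Num.sqrt (\sum_(i < n) v i 0 ^+ 2).

(* Main.v *)
(* With c = lambda / n^2, the matrix A is symmetric and c-coercive, because K is
   positive semidefinite and so is its twist by the signs.  Adding the
   variational inequalities <v - w, A w - b> >= 0 of the two minimisers gives,
   for d = w - w', c |d|^2 <= <d, g> with g = (A' - A) w' + (b - b'), hence
   |d| <= |g| / c.  With M = 2 C (R + 1) / n^2, every entry of g is a sum of n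
   terms bounded by M; outside the row k of the differing record only the k-th
   term is nonzero.  Hence |g|^2 <= n M^2 + (n M)^2 <= 2 n^2 M^2. *)
Require Import Defs.
From mathcomp Require Import all_boot all_order all_algebra.
From mathcomp Require Import all_classical all_reals all_analysis.
From mathcomp Require Import ring lra.

Import Order.TTheory GRing.Theory Num.Theory.
Local Open Scope ring_scope.

(** * Kernels as inner products of features *)

Lemma reproducing_kernel_dot (R : realType) (X : Type) (K : X -> X -> R) :
  reproducing_kernel K ->
  exists (H : completeNormedModType R) (dot : {dot H for idfun}) (phi : X -> H),
    (forall f, 0 <= dot f f) /\ forall x y, K x y = dot (phi x) (phi y).
Proof.
move=> [H [dot [ev [normE _ repr]]]].
(* The feature map sends [x] to the representer of evaluation at [x], so [K x y] is the section at
   [y] evaluated at [x]. *)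
exists H, dot, (fun x => projT1 (cid (repr x))); split=> [f|x y].
  by rewrite -normE exprn_ge0.
case: (cid (repr x)) => /= kx [kxE evx]; case: (cid (repr y)) => /= ky [kyE evy].
by rewrite -kyE evx (hermC dot ky) /= expr0 mul1r.
Qed.

Lemma reproducing_kernel_sym (R : realType) (X : Type) (K : X -> X -> R) :
  reproducing_kernel K -> forall x y, K x y = K y x.
Proof.
move=> /reproducing_kernel_dot [H [dot [phi [_ KE]]]] x y.
by rewrite !KE (hermC dot (phi x)) /= expr0 mul1r.
Qed.

(** The double sum is the squared norm of the combination of features with coefficients [c]. *)
Lemma reproducing_kernel_psd (R : realType) (X : Type) (K : X -> X -> R)
    (n : nat) (x : 'I_n -> X) (c : 'I_n -> R) : reproducing_kernel K ->
  0 <= \sum_(i < n) \sum_(j < n) c i * c j * K (x i) (x j).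
Proof.
move=> /reproducing_kernel_dot [H [dot [phi [dot_ge0 KE]]]].
suff -> : \sum_(i < n) \sum_(j < n) c i * c j * K (x i) (x j) =
    dot (\sum_(i < n) c i *: phi (x i)) (\sum_(i < n) c i *: phi (x i)) by [].
rewrite linear_sumlz; apply: eq_bigr => i _.
rewrite linear_sumr; apply: eq_bigr => j _.
by rewrite KE [RHS]linearZl_LR [X in _ = _ *: X]linearZr_LR /= -mulrA.
Qed.

(** * Constrained minimisers of quadratic objectives *)

Section QuadraticForm.
Variables (R : realType) (n : nat).
Implicit Types (A : 'M[R]_n) (b u v w : 'cV[R]_n).

Lemma dotmxE u v : (u^T *m v) 0 0 = \sum_(i < n) u i 0 * v i 0.
Proof. by rewrite mxE; apply: eq_bigr => i _; rewrite mxE. Qed.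

Lemma mulmx_sym_form A u v : A^T = A ->
  (u^T *m A *m v) 0 0 = (v^T *m A *m u) 0 0.
Proof.
move=> AT; transitivity ((u^T *m A *m v)^T 0 0); first by rewrite [RHS]mxE.
by rewrite !trmx_mul trmxK AT mulmxA.
Qed.

Lemma quadratic_ge0_linear_ge0 (a c : R) :
  (forall t, 0 < t <= 1 -> 0 <= t * (2 * c) + t ^+ 2 * a) -> 0 <= c.
Proof.
move=> H; rewrite leNgt; apply/negP => c0.
(* If [c < 0], this [t] lies in [(0, 1]] and [t * a <= t * |a| = t * c - c], so
   [2 * c + t * a <= c + t * c < 0]. *)
pose t := - c / (`|a| - c).
have den0 : 0 < `|a| - c by have := normr_ge0 a; lra.
have t0 : 0 < t by apply: divr_gt0 => //; lra.
have t1 : t <= 1 by rewrite ler_pdivrMr //; have := normr_ge0 a; lra.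
have tE : t * (`|a| - c) = - c by rewrite mulfVK // gt_eqF.
have := H t; rewrite t0 t1 => /(_ isT).
suff : t * (2 * c) + t ^+ 2 * a < 0 by lra.
have -> : t * (2 * c) + t ^+ 2 * a = t * (2 * c + t * a) by ring.
rewrite pmulr_rlt0 //.
have : t * a <= t * `|a| by rewrite ler_pM2l // ler_norm.
have : t * c < 0 by rewrite pmulr_rlt0.
lra.
Qed.

(** First-order optimality: the ball is convex, so the segment from [w] to [v] is admissible, and
    along it the increase of the objective is a quadratic in [t] whose linear coefficient is twice
    the claimed quantity. *)
Lemma quadratic_argmin_variational A b (r : R) w : A^T = A -> `|w| <= r ->
  (forall v, `|v| <= r -> (w^T *m A *m w) 0 0 - 2 * (w^T *m b) 0 0 <=
                          (v^T *m A *m v) 0 0 - 2 * (v^T *m b) 0 0) ->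
  forall v, `|v| <= r -> 0 <= ((v - w)^T *m (A *m w - b)) 0 0.
Proof.
move=> AT wr wmin v vr.
apply: (@quadratic_ge0_linear_ge0 (((v - w)^T *m A *m (v - w)) 0 0)) => t /andP[t0 t1].
have zr : `|w + t *: (v - w)| <= r.
  have -> : w + t *: (v - w) = (1 - t) *: w + t *: v.
    by apply/matrixP => i j; rewrite !mxE; ring.
  apply: (le_trans (ler_normD _ _)); rewrite !normrZ (gtr0_norm t0) ger0_norm; last lra.
  have : (1 - t) * `|w| <= (1 - t) * r by apply: ler_wpM2l => //; lra.
  have : t * `|v| <= t * r by apply: ler_wpM2l => //; lra.
  lra.
have := wmin _ zr; rewrite -subr_ge0.
set z := v - w => h; apply: (le_trans h); rewrite le_eqVlt; apply/orP; left; apply/eqP.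
clearbody z.
have -> : (w + t *: z)^T = w^T + t *: z^T by apply/matrixP => i j; rewrite !mxE.
rewrite mulmxBr mulmxA.
(* Symmetry of [A] merges the two cross terms of the expansion. *)
have := mulmx_sym_form A w z AT.
rewrite !(mulmxDl, mulmxDr) -!scalemxAl -!scalemxAr.
move: (w^T *m A *m w) (w^T *m A *m z) (z^T *m A *m w) (z^T *m A *m z) (w^T *m b) (z^T *m b).
by move=> p q p' q' e f; rewrite !mxE => ->; ring.
Qed.

(* Expanding [0 <= |g - c d|^2] replaces the Cauchy-Schwarz inequality. *)
Lemma sum_sqr_le_of_coercive (c : R) (d g : 'I_n -> R) : 0 < c ->
  c * \sum_(i < n) d i ^+ 2 <= \sum_(i < n) d i * g i ->
  \sum_(i < n) d i ^+ 2 <= (\sum_(i < n) g i ^+ 2) / c ^+ 2.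
Proof.
move=> c0 H; rewrite ler_pdivlMr ?exprn_gt0 //.
have : 0 <= \sum_(i < n) (g i - c * d i) ^+ 2 by apply: sumr_ge0 => i _; apply: sqr_ge0.
have -> : \sum_(i < n) (g i - c * d i) ^+ 2 = \sum_(i < n) g i ^+ 2
    - 2 * c * (\sum_(i < n) d i * g i) + c ^+ 2 * \sum_(i < n) d i ^+ 2.
  rewrite !mulr_sumr -sumrB -big_split /=; apply: eq_bigr => i _; ring.
have : c * (c * \sum_(i < n) d i ^+ 2) <= c * \sum_(i < n) d i * g i by rewrite ler_pM2l.
lra.
Qed.

Lemma quadratic_argmin_perturbation A A' b b' (r c : R) w w' :
  A^T = A -> A'^T = A' -> 0 < c ->
  (forall v, c * \sum_(i < n) v i 0 ^+ 2 <= (v^T *m A *m v) 0 0) ->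
  `|w| <= r -> `|w'| <= r ->
  (forall v, `|v| <= r -> (w^T *m A *m w) 0 0 - 2 * (w^T *m b) 0 0 <=
                          (v^T *m A *m v) 0 0 - 2 * (v^T *m b) 0 0) ->
  (forall v, `|v| <= r -> (w'^T *m A' *m w') 0 0 - 2 * (w'^T *m b') 0 0 <=
                          (v^T *m A' *m v) 0 0 - 2 * (v^T *m b') 0 0) ->
  \sum_(i < n) (w - w') i 0 ^+ 2 <=
    (\sum_(i < n) ((A' - A) *m w' + (b - b')) i 0 ^+ 2) / c ^+ 2.
Proof.
move=> AT A'T c0 Ac wr w'r wmin w'min.
apply: sum_sqr_le_of_coercive => //; rewrite -[leRHS]dotmxE.
apply: (le_trans (Ac _)).
(* Both problems share the same ball, so each minimiser is a valid test point for the other. *)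
have h := quadratic_argmin_variational _ _ _ _ AT wr wmin _ w'r.
have h' := quadratic_argmin_variational _ _ _ _ A'T w'r w'min _ wr.
have {}h : ((w - w')^T *m (A *m w - b)) 0 0 <= 0.
  suff -> : (w - w')^T = - (w' - w)^T by rewrite mulNmx mxE oppr_le0.
  by apply/matrixP => i j; rewrite !mxE opprB.
move: h h'.
set d := w - w'.
have -> : d^T *m A *m d = d^T *m A *m w - d^T *m A *m w' by rewrite -mulmxBr.
rewrite mulmxBl !(mulmxDr, mulmxN) !mulmxA.
move: (d^T *m A *m w) (d^T *m A *m w') (d^T *m A' *m w') (d^T *m b) (d^T *m b').
by move=> p q p' e f; rewrite !mxE; lra.
Qed.

Lemma mx_norm_entry_le u i : `|u i 0| <= `|u|.
Proof.
rewrite [leRHS]/Num.Def.normr /= mx_normrE.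
exact: (le_bigmax _ (fun ij : 'I_n * 'I_1 => `|u ij.1 ij.2|) (i, 0)).
Qed.

End QuadraticForm.

(** * Estimates for the MMD matrix and gradient *)

Lemma ler_norm_mulB (R : realType) (s s' x x' C : R) :
  `|s| <= 1 -> `|s'| <= 1 -> `|x| <= C -> `|x'| <= C ->
  `|s * x - s' * x'| <= 2 * C.
Proof.
move=> s1 s1' xC xC'.
apply: (le_trans (ler_normB _ _)); rewrite !normrM.
have : `|s| * `|x| <= 1 * C by apply: ler_pM.
have : `|s'| * `|x'| <= 1 * C by apply: ler_pM.
lra.
Qed.

Section MMDEstimates.
Variables (R : realType) (X : Type) (K : X -> X -> R) (alpha lambda : R).
Variable n : nat.
Hypothesis alpha01 : 0 <= alpha <= 1.

Local Notation A := (mmd_A K alpha lambda).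
Local Notation b := (mmd_b K alpha).

Lemma mmd_sign_norm_le1 (D : dataset X n) i j : `|mmd_sign alpha D i j| <= 1.
Proof.
by rewrite /mmd_sign; case: ifP => _; rewrite ?normr1 // ler_norml; move: alpha01; lra.
Qed.

Lemma mmd_A_sym (D : dataset X n) : reproducing_kernel K -> (A D)^T = A D.
Proof.
move=> hK; apply/matrixP => i j; rewrite !mxE /mmd_sign.
rewrite [treatment D j == _]eq_sym [j == i]eq_sym.
by rewrite (reproducing_kernel_sym _ _ _ hK (covariate D j)).
Qed.

(* With [e i = 1] or [-1] according to the treatment of [i], the sign matrix is
   [alpha / 2 + (1 - alpha / 2) * e i * e j], a nonnegative combination of
   matrices of rank one. *)
Lemma mmd_A_coercive (D : dataset X n) (v : 'cV[R]_n) : reproducing_kernel K ->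
  lambda / n%:R ^+ 2 * \sum_(i < n) v i 0 ^+ 2 <= (v^T *m A D *m v) 0 0.
Proof.
move=> hK; pose e i : R := if treatment D i then 1 else -1.
have p1 := reproducing_kernel_psd _ _ _ _ (covariate D) (fun i => v i 0) hK.
have p2 := reproducing_kernel_psd _ _ _ _ (covariate D) (fun i => e i * v i 0) hK.
set S1 := \sum_i _ in p1; set S2 := \sum_i _ in p2.
have -> : (v^T *m A D *m v) 0 0 = lambda / n%:R ^+ 2 * (\sum_(i < n) v i 0 ^+ 2) +
    (n%:R ^+ 2)^-1 * (alpha / 2 * S1 + (1 - alpha / 2) * S2).
  rewrite -mulmxA dotmxE !mulr_sumr -big_split mulr_sumr -big_split /=.
  apply: eq_bigr => i _; rewrite mxE.
  (* The diagonal term is spread over a sum in [j], so that the identity can be checked entry by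
     entry. *)
  have -> : v i 0 ^+ 2 = \sum_(j < n) (i == j)%:R * (v i 0 * v j 0).
    rewrite (bigD1 i) //= eqxx mul1r big1 ?addr0 ?expr2 // => j ji.
    by rewrite eq_sym (negbTE ji) mul0r.
  rewrite !mulr_sumr -big_split /= mulr_sumr -big_split /=.
  apply: eq_bigr => j _; rewrite mxE /mmd_sign /e.
  have n0 : n%:R != 0 :> R by rewrite pnatr_eq0 -lt0n (leq_ltn_trans _ (ltn_ord i)).
  by case: (treatment D i); case: (treatment D j) => /=; field.
rewrite lerDl mulr_ge0 ?invr_ge0 ?exprn_ge0 ?ler0n //.
by apply: addr_ge0; apply: mulr_ge0 => //; move: alpha01; lra.
Qed.

Variables (D D' : dataset X n) (k : 'I_n) (C : R).
Hypothesis DD' : forall i, i != k -> D i = D' i.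
Hypothesis KD : forall i j, `|K (covariate D i) (covariate D j)| <= C.
Hypothesis KD' : forall i j, `|K (covariate D' i) (covariate D' j)| <= C.

Lemma mmd_A_diff_le i j : `|(A D' - A D) i j| <= 2 * C / n%:R ^+ 2.
Proof.
rewrite !mxE -mulrBr normrM ger0_norm ?invr_ge0 ?exprn_ge0 ?ler0n //.
(* The ridge terms in [lambda] coincide in both matrices and cancel. *)
rewrite mulrC ler_wpM2r ?invr_ge0 ?exprn_ge0 ?ler0n // opprD addrACA subrr addr0.
by apply: ler_norm_mulB => //; apply: mmd_sign_norm_le1.
Qed.

Lemma mmd_A_diff_eq0 i j : i != k -> j != k -> (A D' - A D) i j = 0.
Proof.
move=> ik jk; rewrite !mxE /mmd_sign /treatment /covariate.
by rewrite (DD' _ ik) (DD' _ jk) subrr.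
Qed.

(** The sums from the matrix product and from [mmd_b] are merged over one index, so that outside row
    [k] both vanish together for [j != k]. *)
Lemma mmd_gradient_diffE (u : 'cV[R]_n) i :
  ((A D' - A D) *m u + (b D - b D')) i 0 = \sum_(j < n)
    ((A D' - A D) i j * u j 0 + alpha / n%:R ^+ 2 *
     (K (covariate D i) (covariate D j) - K (covariate D' i) (covariate D' j))).
Proof.
rewrite big_split /= mxE [((A D' - A D) *m u) i 0]mxE.
by congr (_ + _); rewrite !mxE -mulrBr -sumrB mulr_sumr.
Qed.

Lemma mmd_gradient_summand_le (u : 'cV[R]_n) (r : R) i j : `|u| <= r ->
  `|(A D' - A D) i j * u j 0 + alpha / n%:R ^+ 2 *
     (K (covariate D i) (covariate D j) - K (covariate D' i) (covariate D' j))|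
  <= 2 * C / n%:R ^+ 2 * (r + 1).
Proof.
move=> ur; apply: (le_trans (ler_normD _ _)).
rewrite [leRHS]mulrDr mulr1; apply: lerD.
  rewrite normrM; apply: ler_pM => //; first exact: mmd_A_diff_le.
  exact: le_trans (mx_norm_entry_le _ _ _ _) ur.
rewrite mulrAC normrM [X in _ * X]ger0_norm ?invr_ge0 ?exprn_ge0 ?ler0n //.
rewrite ler_wpM2r ?invr_ge0 ?exprn_ge0 ?ler0n // mulrBr.
have a1 : `|alpha| <= 1 by rewrite ler_norml; move: alpha01; lra.
exact: ler_norm_mulB.
Qed.

Lemma mmd_gradient_diff_sqr_le (u : 'cV[R]_n) (r : R) : `|u| <= r ->
  \sum_(i < n) ((A D' - A D) *m u + (b D - b D')) i 0 ^+ 2 <=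
    2 * n%:R ^+ 2 * (2 * C / n%:R ^+ 2 * (r + 1)) ^+ 2.
Proof.
move=> ur; set B := 2 * C / _ * _.
have B0 : 0 <= B by apply: le_trans (mmd_gradient_summand_le u r k k ur).
have n1 : 1 <= n%:R :> R by rewrite ler1n (leq_ltn_trans _ (ltn_ord k)).
(* One bound covers all rows: [B ^+ 2] for a single surviving summand, plus [(n%:R * B) ^+ 2] in row
   [k], where all [n] summands may contribute. *)
have g_le i : ((A D' - A D) *m u + (b D - b D')) i 0 ^+ 2 <=
    B ^+ 2 + (i == k)%:R * (n%:R * B) ^+ 2.
  rewrite mmd_gradient_diffE -real_normK ?num_real //.
  have [-> | ik] := eqVneq i k.
    rewrite mul1r; apply: ler_wpDl; first exact: sqr_ge0.
    rewrite lerXn2r ?nnegrE ?(mulr_ge0 (ler0n _ _) B0) //.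
    apply: (le_trans (ler_norm_sum _ _ _)).
    rewrite mulr_natl -[X in B *+ X]card_ord -sumr_const.
    by apply: ler_sum => j _; apply: mmd_gradient_summand_le.
  rewrite mul0r addr0 lerXn2r ?nnegrE //.
  rewrite (bigD1 k) //= big1 ?addr0; first exact: mmd_gradient_summand_le.
  move=> j jk; rewrite mmd_A_diff_eq0 // /covariate (DD' _ ik) (DD' _ jk).
  by rewrite subrr mul0r mulr0 addr0.
apply: (le_trans (ler_sum _ (fun i _ => g_le i))).
rewrite big_split /= sumr_const card_ord (bigD1 k) //= eqxx mul1r big1; last first.
  by move=> i /negbTE ->; rewrite mul0r.
(* As [1 <= n], the total of the single-summand bounds is absorbed into a second copy of
   [(n%:R * B) ^+ 2]. *)
have : n%:R * B ^+ 2 <= n%:R * (n%:R * B ^+ 2).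
  by rewrite ler_wpM2l ?ler0n // ler_peMl ?sqr_ge0.
rewrite -[B ^+ 2 *+ n]mulr_natl; lra.
Qed.

End MMDEstimates.

Theorem proposition4p7 (R : realType) (X : Type) (K : X -> X -> R)
  (alpha lambda Rmmd C : R) (n : nat) (D D' : dataset X n) (w w' : 'cV[R]_n)
  (hK : reproducing_kernel K)
  (halpha : 0 <= alpha <= 1)
  (hlambda : 0 < lambda)
  (hDD' : differ_at_one_point D D')
  (hw : mmd_weights K alpha lambda D Rmmd w)
  (hw' : mmd_weights K alpha lambda D' Rmmd w')
  (hC : 0 < C)
  (hKD : forall i j : 'I_n, `|K (covariate D i) (covariate D j)| <= C)
  (hKD' : forall i j : 'I_n, `|K (covariate D' i) (covariate D' j)| <= C)
  (hwR : `|w| <= Rmmd)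
  (hwR' : `|w'| <= Rmmd) :
  norm2 (w - w') <= 2 * Num.sqrt 2 * (Rmmd + 1) * C * n%:R / lambda.
Proof.
have [k DD'] := hDD'.
have [[_ wmin] [_ w'min]] := (hw, hw').
have n0 : 0 < n%:R :> R by rewrite ltr0n (leq_ltn_trans _ (ltn_ord k)).
have R0 : 0 <= Rmmd by apply: le_trans hwR.
have c0 : 0 < lambda / n%:R ^+ 2 by rewrite divr_gt0 ?exprn_gt0.
have rhs0 : 0 <= 2 * Num.sqrt 2 * (Rmmd + 1) * C * n%:R / lambda.
  by rewrite divr_ge0 ?mulr_ge0 ?sqrtr_ge0 ?addr_ge0 // ltW.
rewrite -(ger0_norm rhs0) -sqrtr_sqr; apply: ler_wsqrtr.
have := quadratic_argmin_perturbation _ _ _ _ _ _ _ _ _ _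
  (mmd_A_sym _ _ _ _ _ _ D hK) (mmd_A_sym _ _ _ _ _ _ D' hK) c0
  (fun v => mmd_A_coercive _ _ _ _ _ _ halpha D v hK) hwR hwR' wmin w'min.
move=> /le_trans; apply.
have := mmd_gradient_diff_sqr_le _ _ _ _ lambda _ halpha _ _ _ _ DD' hKD hKD' _ _ hwR'.
move=> h; rewrite ler_pdivrMr ?exprn_gt0 //; apply: (le_trans h).
(* The constants match exactly: the factors [n%:R ^+ 2] in [B] and in [lambda / n%:R ^+ 2] cancel,
   leaving one [n%:R] and [Num.sqrt 2] after the root. *)
rewrite le_eqVlt; apply/orP; left; apply/eqP.
have -> : (2 * Num.sqrt 2 * (Rmmd + 1) * C * n%:R / lambda) ^+ 2 =
    (Num.sqrt 2) ^+ 2 * (2 * (Rmmd + 1) * C * n%:R / lambda) ^+ 2 by ring.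
rewrite sqr_sqrtr //; field.
by rewrite !gt_eqF.
Qed.
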